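(* Let $n$ be an even positive integer and $m$ a positive integer. For a random chain complex $0\leftarrow A_0\xleftarrow{d_1}A_1\xleftarrow{d_2}\cdots\xleftarrow{d_n}A_n\leftarrow 0$ with $A_i=\mathbb R^{m}$ for every $i=0,\dots,n$, almost surely, for every $k=0,1,\dots,n/2$, \[ \beta_{2k}=\left\lfloor\frac{m}{n/2+1}\right\rfloor\quad\text{or}\quad \beta_{2k}=\left\lceil\frac{m}{n/2+1}\right\rceil. \]
   Context: Model of a random chain complex: fix nonnegative integers $\vec a=(a_0,\dots,a_n)$ and $A_i=\mathbb R^{a_i}$. A sequence of linear maps $d_i:A_i\to A_{i-1}$ ($i=1,\dots,n$) is a point of $\mathbb R^N$, $N=\sum_{i=1}^n a_{i-1}a_i$. Let $M(\vec a)\subseteq\mathbb R^N$ be the real affine algebraic variety of chain complexes ($d_i\circ d_{i+1}=0$ for all $i$); let $k$ be its Hausdorff dimension. Fix a bounded measurable probability density $f$ on $\mathbb R^N$ (e.g.\ standard Gaussian) with $\int_{M(\vec a)} f\,d\mathcal H^k>0$. For a subvariety $Y\subseteq M(\vec a)$ define $\Pr(Y)=\int_Y f\,d\mathcal H^k/\int_{M(\vec a)} f\,d\mathcal H^k$, $\mathcal H^k$ the $k$-dimensional Hausdorff measure. A random chain complex is a point of $M(\vec a)$ under this measure; ''almost surely'' means with probability $1$. Betti numbers: with $r_i=\operatorname{rank} d_i$ and $r_0=r_{n+1}=0$, $\beta_i=a_i-r_i-r_{i+1}$. *)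

(* Defs.v *)
From HB Require Import structures.
From mathcomp Require Import all_boot all_order all_algebra.
From mathcomp Require Import all_classical all_reals all_analysis.
Set Implicit Arguments. Unset Strict Implicit. Unset Printing Implicit Defensive.
Import Order.TTheory GRing.Theory Num.Theory.
Local Open Scope classical_set_scope.
Local Open Scope ring_scope.

Section RandomChainComplex.
Variables (R : realType) (n m : nat).

(* A point of R^N, N = n*m*m : the tuple (d_1,...,d_n) of m x m real matrices
   (all A_i = R^m).  [d i] (i : 'I_n) is the matrix of d_{i+1} : A_{i+1} -> A_i
   acting on column vectors. *)
Definition cfg := 'I_n -> 'M[R]_m.

Definition cdist (d e : cfg) : R :=
  Num.sqrt (\sum_(i < n) \sum_(a < m) \sum_(b < m) (d i a b - e i a b) ^+ 2).

Definition copen (U : set cfg) : Prop :=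
  forall x, U x -> exists2 e : R, 0 < e & forall y, cdist x y < e -> U y.
Definition cborel : set (set cfg) := <<s copen >>.

Definition cborel_fun (f : cfg -> R) : Prop :=
  forall a : R, cborel [set x | a < f x].

Definition cdiam (E : set cfg) : R := sup [set cdist p.1 p.2 | p in E `*` E].

Definition hcost (s : R) (E : set cfg) : \bar R :=
  if pselect (E = set0) then 0%E else (powR (cdiam E) s)%:E.

Definition hausdorff_delta (s delta : R) (A : set cfg) : \bar R :=
  ereal_inf [set (\sum_(i <oo) hcost s (E i))%E | E in
     [set E : nat -> set cfg | A `<=` \bigcup_i E i /\
        forall i x y, E i x -> E i y -> cdist x y <= delta]].

(* (Unnormalized) s-dimensional Hausdorff measure H^s(A) = lim_{delta->0} H^s_delta(A)
   = sup_{delta>0} H^s_delta(A). *)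
Definition hausdorff (s : R) (A : set cfg) : \bar R :=
  ereal_sup [set hausdorff_delta s delta A | delta in [set delta : R | 0 < delta]].

Definition hdim (A : set cfg) : R :=
  inf [set s : R | 0 <= s /\ hausdorff s A = 0%E].

(* Lebesgue integral  \int_Y f dH^s  of a nonnegative function, as the supremum of
   the integrals of nonnegative Borel simple functions below f supported in Y. *)
Definition hintegral (s : R) (Y : set cfg) (f : cfg -> R) : \bar R :=
  ereal_sup [set v : \bar R | exists (K : nat) (c : nat -> R) (A : nat -> set cfg),
     [/\ forall j, 0 <= c j,
          forall j, cborel (A j) /\ A j `<=` Y,
          forall j x, A j x -> c j <= f x,
          forall j j', j <> j' -> A j `&` A j' = set0 &
          v = (\sum_(j < K) (c j)%:E * hausdorff s (A j))%E]].

Definition chain_complexes : set cfg :=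
  [set d | forall i j : 'I_n, val j = (val i).+1 -> d i *m d j = 0].

Definition cprob (f : cfg -> R) (Y : set cfg) : \bar R :=
  let k := hdim chain_complexes in
  (hintegral k Y f * (hintegral k chain_complexes f)^-1)%E.

Definition almost_surely (f : cfg -> R) (P : cfg -> Prop) : Prop :=
  cprob f (chain_complexes `&` [set d | P d]) = 1%E.

(* r_j = rank d_j for 1 <= j <= n, and r_0 = r_{n+1} = 0. *)
Definition crank (d : cfg) (j : nat) : nat :=
  (\sum_(i < n | (val i).+1 == j) \rank (d i))%N.

Definition betti (d : cfg) (j : nat) : nat := (m - crank d j - crank d j.+1)%N.

End RandomChainComplex.

(* Main.v *)
(* Stratify the complexes by their ranks (r_i).  A complex with pivot columns J_i
   for d_i factors as d_i = (Q_(i-1) - X_(i-1)) U_i (P_i + X_i), where P_i and Q_i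
   are the coordinate projections onto J_i and its complement; the free entries of
   the U_i and X_i exhibit the stratum as a finite union of polynomial images of
   R^D with D = sum_i (m - r_(i-1)) r_i + r_i (m - r_i), so its H^s vanishes for
   s > D.  Conversely D of the matrix entries can be prescribed freely in a cube,
   so the 1-Lipschitz projection to these entries bounds dim M from below by D.
   Since 2 D + sum_i beta_i^2 = (n + 1) m^2 while the Euler characteristic forces
   sum_k beta_(2k) = m + sum_k beta_(2k+1), the dimension D is largest exactly when
   the odd Betti numbers vanish and the even ones are balanced; every stratum with
   an unbalanced even Betti number is H^(dim M)-null. *)
Require Import Defs.
From HB Require Import structures.
From mathcomp Require Import all_boot all_order all_algebra.
From mathcomp Require Import all_classical all_reals all_analysis.
From mathcomp Require Import measurable_realfun ring lra zify.
Import Order.TTheory GRing.Theory Num.Theory.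
Import numFieldNormedType.Exports.
Local Open Scope classical_set_scope.
Local Open Scope ring_scope.

(** * Hausdorff measure *)

Section Hausdorff.
Context {R : realType} {n m : nat}.
Local Notation cfg := (cfg R n m).
Implicit Types (s delta : R) (A B : set cfg) (d e : cfg).

Lemma hcost_ge0 s A : (0 <= hcost s A)%E.
Proof.
by rewrite /hcost; case: pselect => [?|?]; rewrite ?lexx ?lee_fin ?powR_ge0.
Qed.

Lemma hcost0 s : hcost s (set0 : set cfg) = 0%E.
Proof. by rewrite /hcost; case: pselect. Qed.

Lemma hausdorff_delta_ge0 s delta A : (0 <= hausdorff_delta s delta A)%E.
Proof.
apply: le_ereal_inf_tmp => _ [E _ <-].
by apply: nneseries_ge0 => i _ _; exact: hcost_ge0.
Qed.

Lemma hausdorff_delta_le s delta A :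
  0 < delta -> (hausdorff_delta s delta A <= hausdorff s A)%E.
Proof. by move=> delta0; apply: ereal_sup_ubound; exists delta. Qed.

Lemma hausdorff_ge0 s A : (0 <= hausdorff s A)%E.
Proof.
exact: le_trans (hausdorff_delta_ge0 s 1 A) (hausdorff_delta_le _ _ _ ltr01).
Qed.

Lemma hausdorff_delta_subset s delta A B :
  A `<=` B -> (hausdorff_delta s delta A <= hausdorff_delta s delta B)%E.
Proof.
move=> AB; apply: le_ereal_inf => _ [E [BE dE] <-].
by exists E => //; split=> //; exact: subset_trans BE.
Qed.

Lemma hausdorff_subset s A B : A `<=` B -> (hausdorff s A <= hausdorff s B)%E.
Proof.
move=> AB; apply: ge_ereal_sup => _ [delta /= delta0 <-].
apply: le_trans (hausdorff_delta_le _ _ _ delta0).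
exact: hausdorff_delta_subset.
Qed.

(** Covers indexed by any countable type may be used: codes that [pickle] does not reach are filled
    with the empty set, which costs nothing. *)
Lemma hausdorff_delta_countable_cover (T : countType) s delta A
    (E : T -> set cfg) :
  A `<=` \bigcup_t E t ->
  (forall t x y, E t x -> E t y -> cdist x y <= delta) ->
  (hausdorff_delta s delta A <= \esum_(t in [set: T]) hcost s (E t))%E.
Proof.
move=> AE dE.
pose E' i := if pickle_inv i is Some t then E t else set0 : set cfg.
have E'K t : E' (pickle t) = E t by rewrite /E' pickleK_inv.
apply: (@le_trans _ _ (\sum_(i <oo) hcost s (E' i))%E).
  apply: ereal_inf_lbound; exists E' => //; split.
    by move=> x /AE[t _ Etx]; exists (pickle t) => //; rewrite E'K.
  by move=> i x y; rewrite /E'; case: pickle_inv => // t; exact: dE.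
rewrite nneseries_esumT; last by move=> i; exact: hcost_ge0.
rewrite (_ : \esum_(i in setT) _ = \esum_(i in pickle @` [set: T]) hcost s (E' i))%E.
  rewrite esum_image; last by move=> t u _ _; exact: (pcan_inj pickleK_inv).
  by apply: le_esum => t _; rewrite E'K.
rewrite [RHS]esum_mkcond; apply: eq_esum => i _; case: ifPn => //.
rewrite notin_setE => Ni; rewrite /E'.
case pi: (pickle_inv i) => [t|]; last exact: hcost0.
by exfalso; apply: Ni; exists t => //; have := @pickle_invK T i; rewrite pi.
Qed.

Lemma hausdorff_delta_sigma_subadditive s delta (A : nat -> set cfg) :
  (hausdorff_delta s delta (\bigcup_k A k) <=
   \sum_(k <oo) hausdorff_delta s delta (A k))%E.
Proof.
(* If one term is infinite, so is the right-hand side. Otherwise every infimum is finite and has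
   near-optimal covers, the [k]-th within [e / 2 ^ k.+1]; merged over [nat * nat], they cover the
   union. *)
have [[k koo]|] := pselect (exists k, hausdorff_delta s delta (A k) = +oo%E).
  rewrite (eseries_pinfty _ _ koo) ?leey// => i _.
  by rewrite -ltNye (lt_le_trans _ (hausdorff_delta_ge0 _ _ _)).
rewrite -forallNE => Afin; apply/lee_addgt0Pr => e e0.
apply: le_trans (epsilon_trick xpredT _ (ltW e0)); last first.
  by move=> i; exact: hausdorff_delta_ge0.
pose P k (E : nat -> set cfg) :=
  [/\ A k `<=` \bigcup_i E i,
      forall i x y, E i x -> E i y -> cdist x y <= delta &
      (\sum_(i <oo) hcost s (E i) <=
         hausdorff_delta s delta (A k) + (e / (2 ^ k.+1)%:R)%:E)%E].
have [G PG] : {G & forall k, P k (G k)}.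
  apply: choice => k.
  have e2 : 0 < e / (2 ^ k.+1)%:R by rewrite divr_gt0// ltr0n expn_gt0.
  have fin : hausdorff_delta s delta (A k) \is a fin_num.
    by rewrite ge0_fin_numE ?hausdorff_delta_ge0// ltey; exact/eqP/Afin.
  have [_ [E [AE dE] <-] lt] := lb_ereal_inf_adherent e2 fin.
  by exists E; split=> //; exact: ltW.
apply: le_trans (hausdorff_delta_countable_cover _ s delta _
   (fun t : nat * nat => G t.1 t.2) _ _) _.
- move=> x [k _ Akx]; have [/(_ _ Akx)[i _ Gx] _ _] := PG k.
  by exists (k, i).
- by move=> [k i] x y /=; have [_ + _] := PG k; exact.
rewrite (_ : [set: nat * nat] = [set: nat] `*`` (fun=> [set: nat])); last first.
  by apply/seteqP; split.
rewrite -(@esum_esum _ _ _ setT (fun=> setT) (fun k i => hcost s (G k i))); last first.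
  by move=> *; exact: hcost_ge0.
rewrite nneseries_esumT; last first.
  move=> k; rewrite adde_ge0 ?hausdorff_delta_ge0// lee_fin.
  by rewrite divr_ge0// ltW.
apply: le_esum => k _; rewrite -nneseries_esumT; last by move=> i; exact: hcost_ge0.
by have [] := PG k.
Qed.

Lemma hausdorff_bigcup0 s (A : nat -> set cfg) :
  (forall k, hausdorff s (A k) = 0%E) -> hausdorff s (\bigcup_k A k) = 0%E.
Proof.
move=> A0; apply/eqP; rewrite eq_le hausdorff_ge0 andbT.
apply: ge_ereal_sup => _ [delta /= delta0 <-].
apply: le_trans (hausdorff_delta_sigma_subadditive _ _ _) _.
rewrite eseries0// => k _ _; apply/eqP.
by rewrite eq_le hausdorff_delta_ge0 andbT -(A0 k) hausdorff_delta_le.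
Qed.

Lemma hausdorff_countable_bigcup0 (T : countType) s (A : T -> set cfg) :
  (forall t, hausdorff s (A t) = 0%E) -> hausdorff s (\bigcup_t A t) = 0%E.
Proof.
move=> A0.
pose A' i := if pickle_inv i is Some t then A t else set0 : set cfg.
have H0 : hausdorff s (set0 : set cfg) = 0%E.
  apply/eqP; rewrite eq_le hausdorff_ge0 andbT.
  apply: ge_ereal_sup => _ [delta /= delta0 <-].
  apply: ereal_inf_lbound; exists (fun=> set0); first by split.
  by rewrite eseries0// => k _ _; rewrite hcost0.
rewrite (_ : \bigcup_t A t = \bigcup_i A' i); last first.
  apply/seteqP; split=> [x [t _ Atx]|x [i _]]; rewrite /A'.
    by exists (pickle t) => //; rewrite pickleK_inv.
  by case: pickle_inv => // t; exists t.
by apply: hausdorff_bigcup0 => i; rewrite /A'; case: pickle_inv.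
Qed.

Lemma hausdorff_setI_conull s A B N :
  A `<=` B `|` N -> hausdorff s N = 0%E -> hausdorff s (A `&` B) = hausdorff s A.
Proof.
move=> ABN N0; apply/eqP; rewrite eq_le hausdorff_subset//=.
apply: ge_ereal_sup => _ [delta /= delta0 <-].
apply: le_trans (hausdorff_delta_le _ _ _ delta0).
(* The cover repeats the null set [N] at every index but the first, so only the first term of the
   sum survives. *)
pose C k : set cfg := if k is 0 then A `&` B else N.
apply: (@le_trans _ _ (hausdorff_delta s delta (\bigcup_k C k))).
  apply: hausdorff_delta_subset => x Ax.
  by have [Bx|Nx] := ABN _ Ax; [exists 0%N|exists 1%N].
apply: le_trans (hausdorff_delta_sigma_subadditive _ _ _) _.
rewrite (nneseries_split 0 1); last by move=> *; exact: hausdorff_delta_ge0.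
rewrite add0n big_nat1 [X in (_ + X)%E]eseries0 ?adde0// => k k0 _; apply/eqP.
rewrite eq_le hausdorff_delta_ge0 andbT -N0.
by case: k k0 => // k _; exact: hausdorff_delta_le.
Qed.

Lemma cdist_ge0 d e : 0 <= cdist d e.
Proof. exact: sqrtr_ge0. Qed.

Lemma le_entry_cdist d e i a b : `|d i a b - e i a b| <= cdist d e.
Proof.
rewrite -sqrtr_sqr ler_wsqrtr// (bigD1 i)//= (bigD1 a)//= (bigD1 b)//=.
rewrite -!addrA lerDl !addr_ge0//; repeat apply: sumr_ge0 => ? _;
  exact: sqr_ge0.
Qed.

Lemma cdist_le_entries d e (c : R) : 0 <= c ->
  (forall i a b, `|d i a b - e i a b| <= c) ->
  cdist d e <= Num.sqrt (n * m * m)%:R * c.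
Proof.
move=> c0 dc; rewrite -(ger0_norm c0) -sqrtr_sqr -sqrtrM// ler_wsqrtr//.
apply: (@le_trans _ _ (\sum_(i < n) \sum_(a < m) \sum_(b < m) c ^+ 2)).
  apply: ler_sum => i _; apply: ler_sum => a _; apply: ler_sum => b _.
  by rewrite -real_normK ?num_real// lerXn2r ?nnegrE.
rewrite !sumr_const !card_ord -!mulrnA mulr_natl.
by rewrite [leLHS](_ : _ = c ^+ 2 *+ (n * m * m)) //; congr (_ *+ _); lia.
Qed.

Lemma cdiam_le A (c : R) : A !=set0 ->
  (forall x y, A x -> A y -> cdist x y <= c) -> cdiam A <= c.
Proof.
move=> [x Ax] Ac; apply: ge_sup; first by exists (cdist x x), (x, x).
by move=> _ [[y z] [/= Ay Az] <-]; exact: Ac.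
Qed.

(** The uniform bound [c] is what makes [cdiam A] a genuine least upper bound: [sup] takes a default
    value on unbounded sets. *)
Lemma cdist_le_cdiam A (c : R) x y :
  (forall x y, A x -> A y -> cdist x y <= c) ->
  A x -> A y -> cdist x y <= cdiam A.
Proof.
move=> Ac Ax Ay; apply: ub_le_sup; last by exists (x, y).
by exists c => _ [[u v] [/= Au Av] <-]; exact: Ac.
Qed.

End Hausdorff.

(** * Lipschitz images of boxes *)

Set Implicit Arguments.
Unset Strict Implicit.
Unset Printing Implicit Defensive.

Lemma esum_finType (R : realType) (T : finType) (f : T -> \bar R) :
  (forall t, 0 <= f t)%E -> (\esum_(t in [set: T]) f t = \sum_t f t)%E.
Proof.
move=> f0; rewrite -(set_mem_set [set: T]) esum_fset//.
rewrite set_mem_set fsbig_finite//=.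
apply/perm_big/uniq_perm; rewrite ?finmap.fset_uniq ?index_enum_uniq// => t.
by rewrite (in_fset_set finite_finset) mem_index_enum mem_set.
Qed.

Section LipschitzImages.
Context {R : realType} {T : finType}.
Implicit Types (p q : T -> R) (g h : (T -> R) -> R) (L : R).

Definition in_box L p := forall t, `|p t| <= L.

(** Lipschitz for the sup norm, with a constant that may depend on the box. Unlike the global
    Lipschitz property this is stable under products, so all polynomials have it. *)
Definition lipschitz_on_boxes g := forall L, 0 <= L ->
  exists2 c : R, 0 <= c & forall p q (e : R), in_box L p -> in_box L q ->
    (forall t, `|p t - q t| <= e) -> 0 <= e -> `|g p - g q| <= c * e.

Lemma lipschitz_on_boxes_cst (k : R) : lipschitz_on_boxes (fun=> k).
Proof. by move=> L _; exists 0 => // p q e _ _ _ _; rewrite subrr normr0 mul0r. Qed.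

Lemma lipschitz_on_boxes_proj t : lipschitz_on_boxes (fun p => p t).
Proof. by move=> L _; exists 1 => // p q e _ _ pq _; rewrite mul1r. Qed.

Lemma lipschitz_on_boxesD g h : lipschitz_on_boxes g -> lipschitz_on_boxes h ->
  lipschitz_on_boxes (fun p => g p + h p).
Proof.
move=> gl hl L L0; have [c c0 gc] := gl L L0; have [k k0 hk] := hl L L0.
exists (c + k) => [|p q e Lp Lq pq e0]; first exact: addr_ge0.
rewrite opprD addrACA mulrDl (le_trans (ler_normD _ _))// lerD//.
  exact: gc.
exact: hk.
Qed.

Lemma lipschitz_on_boxes_bounded g L : 0 <= L -> lipschitz_on_boxes g ->
  exists2 c : R, 0 <= c & forall p, in_box L p -> `|g p| <= c.
Proof.
move=> L0 gl; have [c c0 gc] := gl L L0.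
exists (`|g (fun=> 0)| + c * L) => [|p Lp]; first by rewrite addr_ge0// mulr_ge0.
rewrite -[g p](subrKC (g (fun=> 0))) (le_trans (ler_normD _ _))// lerD2l.
apply: gc => // t; first by rewrite normr0.
by rewrite subr0.
Qed.

Lemma lipschitz_on_boxesM g h : lipschitz_on_boxes g -> lipschitz_on_boxes h ->
  lipschitz_on_boxes (fun p => g p * h p).
Proof.
move=> gl hl L L0; have [c c0 gc] := gl L L0; have [k k0 hk] := hl L L0.
have [a a0 ga] := lipschitz_on_boxes_bounded L0 gl.
have [b b0 hb] := lipschitz_on_boxes_bounded L0 hl.
exists (c * b + a * k) => [|p q e Lp Lq pq e0]; first by rewrite addr_ge0// mulr_ge0.
(* Product rule for differences; the undifferenced factors are bounded by [b] and [a] on the box. *)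
rewrite (_ : g p * h p - _ = (g p - g q) * h p + g q * (h p - h q)); last by ring.
rewrite (le_trans (ler_normD _ _))// !normrM mulrDl lerD//.
  by rewrite mulrAC ler_pM//; [exact: gc|exact: hb].
by rewrite -mulrA ler_pM//; [exact: ga|exact: hk].
Qed.

Lemma lipschitz_on_boxes_sum (I : Type) (r : seq I) (G : I -> (T -> R) -> R) :
  (forall i, lipschitz_on_boxes (G i)) ->
  lipschitz_on_boxes (fun p => \sum_(i <- r) G i p).
Proof.
move=> Gl; elim: r => [|i r IH].
  move=> L _; exists 0 => // p q e _ _ _ _.
  by rewrite !big_nil subrr normr0 mul0r.
move=> L L0; have [c c0 Hc] := lipschitz_on_boxesD (Gl i) IH L0.
by exists c => // p q e *; rewrite !big_cons; exact: Hc.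
Qed.

Lemma lipschitz_on_boxes_mulmx (j k l : nat) (A : (T -> R) -> 'M[R]_(j, k))
    (B : (T -> R) -> 'M[R]_(k, l)) :
  (forall a b, lipschitz_on_boxes (fun p => A p a b)) ->
  (forall a b, lipschitz_on_boxes (fun p => B p a b)) ->
  forall a b, lipschitz_on_boxes (fun p => (A p *m B p) a b).
Proof.
move=> Al Bl a b; rewrite (_ : (fun p => _) =
    fun p => \sum_(c < k) A p a c * B p c b); last first.
  by apply/funext => p; rewrite mxE.
by apply: lipschitz_on_boxes_sum => c; exact: lipschitz_on_boxesM.
Qed.

End LipschitzImages.

Section LipschitzImageDimension.
Context {R : realType} {T : finType} {n m : nat}.
Local Notation cfg := (cfg R n m).
Variable Phi : (T -> R) -> cfg.
Hypothesis Phi_lip : forall i a b, lipschitz_on_boxes (fun p => Phi p i a b).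

Lemma cdist_lipschitz L : 0 <= L ->
  exists2 c : R, 0 < c & forall p q (e : R), in_box L p -> in_box L q ->
    (forall t, `|p t - q t| <= e) -> 0 <= e -> cdist (Phi p) (Phi q) <= c * e.
Proof.
move=> L0.
have /choice[c Hc] : forall x : 'I_n * 'I_m * 'I_m, exists c : R, 0 <= c /\
    forall p q (e : R), in_box L p -> in_box L q ->
    (forall t, `|p t - q t| <= e) -> 0 <= e ->
    `|Phi p x.1.1 x.1.2 x.2 - Phi q x.1.1 x.1.2 x.2| <= c * e.
  move=> [[i a] b].
  by have [k k0 Hk] := Phi_lip i a b L0; exists k.
pose k := \sum_x c x.
have ck x : c x <= k.
  by rewrite /k (bigD1 x)//= lerDl sumr_ge0// => y _; have [] := Hc y.
have k0 : 0 <= k by rewrite sumr_ge0// => y _; have [] := Hc y.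
(* The added 1 makes the constant strictly positive, so that one may divide by it. *)
exists (Num.sqrt (n * m * m)%:R * k + 1) => [|p q e Lp Lq pq e0].
  by rewrite ltr_wpDl// mulr_ge0// sqrtr_ge0.
have : cdist (Phi p) (Phi q) <= Num.sqrt (n * m * m)%:R * (k * e).
  apply: cdist_le_entries => [|i a b]; first exact: mulr_ge0.
  have [_ /(_ p q e Lp Lq pq e0) /= /le_trans] := Hc (i, a, b); apply.
  by rewrite ler_wpM2r.
by move=> /le_trans; apply; rewrite mulrA ler_wpM2r// lerDl.
Qed.

(* The box is cut into [N ^ #|T|] cubes, whose images have diameter at most
   [K / N]; their total cost is [K ^ #|T| * (K / N) `^ (s - #|T|)]. *)
Lemma hausdorff_image_box (L s : R) : 0 < L -> #|T|%:R < s ->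
  hausdorff s [set Phi p | p in [set p | forall t, `|p t| < L]] = 0%E.
Proof.
move=> L0 Ts; set A := (X in hausdorff s X).
apply/eqP; rewrite eq_le hausdorff_ge0 andbT.
apply: ge_ereal_sup => _ [delta /= delta0 <-].
apply/lee_addgt0Pr => e e0; rewrite add0e.
have [c c0 Hc] := cdist_lipschitz (ltW L0).
pose K := c * (2 * L).
have K0 : 0 < K by rewrite !mulr_gt0.
have sT0 : 0 < s - #|T|%:R by rewrite subr_gt0.
pose eta0 := Num.min delta ((e / K ^+ #|T|) `^ (s - #|T|%:R)^-1).
have eta00 : 0 < eta0.
  by rewrite lt_min delta0 powR_gt0// divr_gt0// exprn_gt0.
pose N := (Num.truncn (K / eta0)).+1.
have N0 : 0 < N%:R :> R by rewrite ltr0n.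
pose eta := K / N%:R.
have eta_gt0 : 0 < eta by rewrite divr_gt0.
have le_eta : eta <= eta0.
  rewrite ler_pdivrMr// mulrC -ler_pdivrMr//.
  exact/ltW/truncnS_gt.
pose cell (g : {ffun T -> 'I_N}) : set (T -> R) :=
  [set p | in_box L p /\ forall t, 0 <= p t - (2 * L * (g t)%:R / N%:R - L) <= 2 * L / N%:R].
have cellP g x y : (Phi @` cell g) x -> (Phi @` cell g) y -> cdist x y <= eta.
  move=> [p [Lp gp] <-] [q [Lq gq] <-].
  rewrite (_ : eta = c * (2 * L / N%:R)); last by rewrite /eta /K !mulrA.
  apply: Hc => // [t|]; last by rewrite divr_ge0// mulr_ge0// ltW.
  move: (gp t) (gq t) => /andP[? ?] /andP[? ?].
  by rewrite ler_norml; apply/andP; split; lra.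
have Acell : A `<=` \bigcup_(g : {ffun T -> 'I_N}) (Phi @` cell g).
  move=> _ [p Lp <-].
  have idx t : {j : 'I_N | 0 <= p t - (2 * L * j%:R / N%:R - L) <= 2 * L / N%:R}.
    have /andP[Lpt ptL] : - L < p t < L by rewrite -ltr_norml Lp.
    (* The coordinate rescaled to [[0, N[]; its integer part is the index of the subinterval. *)
    pose x := (p t + L) * N%:R / (2 * L).
    have L20 : 0 < 2 * L by rewrite mulr_gt0.
    have x0 : 0 <= x by rewrite divr_ge0 ?mulr_ge0//; lra.
    have xN : x < N%:R.
      by rewrite ltr_pdivrMr// mulrC ltr_pM2l//; lra.
    have /andP[tx xt] := truncn_itv x0.
    have jN : (Num.truncn x < N)%N by rewrite -(ltr_nat R) (le_lt_trans tx).
    exists (Ordinal jN) => /=.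
    have -> : p t = 2 * L * x / N%:R - L by rewrite /x; field; rewrite !gt_eqF.
    rewrite (_ : _ - _ - _ = 2 * L / N%:R * (x - (Num.truncn x)%:R)); last by ring.
    have ? : 0 <= 2 * L / N%:R by rewrite divr_ge0// ltW.
    apply/andP; split; first by rewrite mulr_ge0// subr_ge0.
    by rewrite ler_piMr// lerBlDl natr1 ltW.
  exists [ffun t => sval (idx t)] => //; exists p => //; split.
    by move=> t; exact/ltW/Lp.
  by move=> t; rewrite ffunE; exact: (svalP (idx t)).
apply: le_trans (hausdorff_delta_countable_cover _ s delta _ _ Acell _) _.
  move=> g x y gx gy; rewrite (le_trans (cellP g _ _ gx gy))//.
  by rewrite (le_trans le_eta)// ge_min lexx.
have le_cost g : (hcost s (Phi @` cell g) <= (eta `^ s)%:E)%E.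
  rewrite /hcost; case: pselect => [?|g0]; first by rewrite lee_fin powR_ge0.
  have ngt0 : Phi @` cell g !=set0 by exact/set0P/eqP.
  rewrite lee_fin ge0_ler_powR ?nnegrE ?(ltW eta_gt0)//.
  - by rewrite (le_trans _ (ltW Ts)).
  - have [x gx] := ngt0.
    exact: le_trans (cdist_ge0 x x) (cdist_le_cdiam _ _ _ _ (cellP g) gx gx).
  - exact: cdiam_le (cellP g).
apply: (@le_trans _ _ (\sum_(g : {ffun T -> 'I_N}) (eta `^ s)%:E)%E).
  by rewrite esum_finType ?lee_sum// => g; exact: hcost_ge0.
rewrite sumEFin sumr_const card_ffun card_ord lee_fin.
rewrite -(subrK #|T|%:R s) powRD; last by rewrite (gt_eqF eta_gt0) implybT.
rewrite powR_mulrn ?(ltW eta_gt0)// -[leLHS]mulr_natr natrX -mulrA -exprMn.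
rewrite (_ : eta * N%:R = K); last by rewrite /eta divfK// gt_eqF.
rewrite -ler_pdivlMr ?exprn_gt0//.
apply: (@le_trans _ _ (eta0 `^ (s - #|T|%:R))).
  by rewrite ge0_ler_powR ?nnegrE ?(ltW sT0) ?(ltW eta_gt0) ?(ltW eta00).
apply: (@le_trans _ _ (((e / K ^+ #|T|) `^ (s - #|T|%:R)^-1) `^ (s - #|T|%:R))).
  by rewrite ge0_ler_powR ?nnegrE ?powR_ge0 ?(ltW sT0) ?(ltW eta00)// ge_min lexx orbT.
rewrite -powRrM mulVf ?gt_eqF// powRr1// divr_ge0 ?(ltW e0)//.
by rewrite exprn_ge0// ltW.
Qed.

Lemma hausdorff_image (s : R) : #|T|%:R < s -> hausdorff s (range Phi) = 0%E.
Proof.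
move=> Ts; rewrite (_ : range Phi = \bigcup_(k : nat)
    [set Phi p | p in [set p | forall t, `|p t| < k.+1%:R]]); last first.
  apply/seteqP; split=> [_ [p _ <-]|_ [k _ [p _ <-]]]; last by exists p.
  exists (Num.truncn (\sum_t `|p t|)) => //; exists p => //= t.
  apply: le_lt_trans (truncnS_gt _).
  by rewrite (bigD1 t)//= lerDl sumr_ge0.
by apply: hausdorff_bigcup0 => k; apply: hausdorff_image_box.
Qed.

End LipschitzImageDimension.

(** * Sets projecting onto a cube *)

(* Induction on the dimension: integrating the slice inequality over the last
   coordinate multiplies the weight of the i-th box by the length of its last
   side. *)
Lemma weighted_box_cover (R : realType) (D : nat) (c : nat -> R)
    (lo hi : nat -> nat -> R) :
  (forall i, 0 <= c i) -> (forall i j, lo i j <= hi i j) ->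
  (forall x : nat -> R, (forall j, 0 <= x j <= 1) ->
    (1 <= \sum_(i <oo) (c i * \prod_(j < D) \1_`[lo i j, hi i j] (x j))%:E)%E) ->
  (1 <= \sum_(i <oo) (c i * \prod_(j < D) (hi i j - lo i j))%:E)%E.
Proof.
elim: D c => [|D IH] c c0 lohi cover.
  rewrite [leRHS](_ : _ = (\sum_(i <oo) (c i * \prod_(j < 0) \1_`[lo i j, hi i j] (0 : R))%:E)%E).
    by apply: (cover (fun=> 0)) => j; rewrite lexx ler01.
  by apply: eq_eseriesr => i _; rewrite !big_ord0.
pose W i := \prod_(j < D) (hi i j - lo i j).
have W0 i : 0 <= W i by apply: prodr_ge0 => j _; rewrite subr_ge0.
have slice (t : R) : `[0, 1]%classic t ->
    (1 <= \sum_(i <oo) ((c i * W i)%:E * (\1_`[lo i D, hi i D] t)%:E))%E.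
  rewrite /= in_itv/= => t01.
  rewrite (_ : (\sum_(i <oo) _)%E =
     (\sum_(i <oo) ((c i * \1_`[lo i D, hi i D] t) * W i)%:E)%E); last first.
    by apply: eq_eseriesr => i _; rewrite -EFinM mulrAC.
  apply: IH => // [i|x x01]; first by rewrite mulr_ge0.
  (* The point of the slice is completed by [t] in coordinate [D]. *)
  apply: le_trans (cover (fun j => if (j < D)%N then x j else t) _) _.
    by move=> j; case: ifP.
  rewrite le_eqVlt; apply/orP; left; apply/eqP/eq_eseriesr => i _.
  rewrite big_ord_recr/= ltnn mulrA [in LHS]mulrAC.
  congr (_ * _ * _)%:E.
  by apply: eq_bigr => j _; rewrite ltn_ord.
pose I01 : set R := `[0, 1]%classic.
have m01 : measurable I01 by exact: measurable_itv.
pose F i (t : R) : \bar R := ((c i * W i)%:E * (\1_`[lo i D, hi i D] t)%:E)%E.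
have mf i : measurable_fun I01 (F i).
  apply: emeasurable_funM => //; apply/measurable_EFinP.
  exact: measurable_indic.
have f0 i t : (0 <= F i t)%E.
  by rewrite /F -EFinM lee_fin !mulr_ge0.
have : (\int[@lebesgue_measure R]_(t in I01) 1 <= \int[@lebesgue_measure R]_(t in I01)
    (\sum_(i <oo) F i t))%E.
  apply: ge0_le_integral => //.
  exact: (@ge0_emeasurable_sum _ _ _ I01 F xpredT (fun i t _ _ => f0 i t) (fun i _ => mf i)).
rewrite integral_cst// mul1e [X in (X <= _)%E]lebesgue_measure_itv/= lte_fin ltr01.
rewrite -EFinB subr0 integral_nneseries// => /le_trans; apply.
apply: lee_nneseries => [i _ _|i _].
  by apply: integral_ge0 => t _; exact: f0.
rewrite /F ge0_integralZl//=; last 2 first.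
- by apply/measurable_EFinP; exact: measurable_indic.
- by rewrite lee_fin mulr_ge0.
rewrite integral_indic// big_ord_recr/= mulrA [leRHS]EFinM lee_wpmul2l//.
  by rewrite lee_fin mulr_ge0.
apply: (@le_trans _ _ (lebesgue_measure (`[lo i D, hi i D]%classic : set R))).
  by apply: le_measure; rewrite ?inE//; exact: measurableI.
rewrite lebesgue_measure_itv/= lte_fin; case: ifP => // _.
by rewrite lee_fin subr_ge0.
Qed.

Section LowerBound.
Context {R : realType} {n m : nat} {T : finType}.
Local Notation cfg := (cfg R n m).
Variables (pr : cfg -> T -> R) (A : set cfg).
Hypothesis pr_lip : forall d e t, `|pr d t - pr e t| <= cdist d e.
Hypothesis pr_cube : forall z : T -> R, (forall t, 0 <= z t <= 1) ->
  exists2 d, A d & forall t, pr d t = z t.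

(** If [s < #|T|], take a cover by sets of diameter at most 1 and total cost below [2 ^- #|T|]. The
    cubes of side twice the diameter around projected centres cover the unit cube, so their volumes
    sum to at least 1. But each volume is at most [2 ^+ #|T|] times the cost, since a diameter at
    most 1 only grows when the exponent drops from [#|T|] to [s]. *)
Lemma hausdorff0_dim_ge (s : R) : 0 <= s -> hausdorff s A = 0%E -> #|T|%:R <= s.
Proof.
move=> s0 As0; rewrite leNgt; apply/negP => sT.
have A10 : hausdorff_delta s 1 A = 0%E.
  by apply/eqP; rewrite eq_le hausdorff_delta_ge0 andbT -As0 hausdorff_delta_le.
have e0 : 0 < (2 ^+ #|T|)^-1 :> R by rewrite invr_gt0 exprn_gt0.
have fin : hausdorff_delta s 1 A \is a fin_num by rewrite A10.
have [_ [E [AE dE] <-]] := lb_ereal_inf_adherent e0 fin.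
rewrite -/(hausdorff_delta s 1 A) A10 add0e.
(* Empty sets cost 0 and have no centre, so their boxes get weight 0. *)
pose c i : R := if pselect (E i = set0) then 0 else 1.
have c0 i : 0 <= c i by rewrite /c; case: pselect.
have dist0 (x : cfg) : cdist x x = 0.
  rewrite /cdist big1 ?sqrtr0// => i _; rewrite big1// => a _; rewrite big1// => b _.
  by rewrite subrr expr0n.
have diam_ge0 i : 0 <= cdiam (E i).
  have [->|/set0P[x Ex]] := eqVneq (E i) set0.
    by rewrite /cdiam set0X image_set0 sup0.
  by rewrite -(dist0 x); exact: (cdist_le_cdiam _ _ _ _ (dE i) Ex Ex).
have /choice[ctr Hctr] : forall i, exists x, E i !=set0 -> E i x.
  by move=> i; have [[x Ex]|] := pselect (E i !=set0); [exists x|exists (fun=> 0)].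
pose pr' d j := if insub j is Some k then pr d (enum_val (k : 'I_#|T|)) else 0.
pose lo i j := pr' (ctr i) j - cdiam (E i).
pose hi i j := pr' (ctr i) j + cdiam (E i).
have : (1 <= \sum_(i <oo) (c i * \prod_(j < #|T|) (hi i j - lo i j))%:E)%E.
  apply: weighted_box_cover => // [i j|x x01].
    by rewrite /lo /hi lerD2l ge0_cp.
  have [d Ad prd] := @pr_cube (fun t => x (enum_rank t)) (fun t => x01 _).
  have [i _ Eid] := AE _ Ad.
  apply: (@le_trans _ _ (\sum_(i < i.+1)
      (c i * \prod_(j < #|T|) \1_`[lo i j, hi i j] (x j))%:E)%E).
    rewrite big_ord_recr/=.
    have -> : c i = 1 by rewrite /c; case: pselect => // E0; rewrite E0 in Eid.
    rewrite [X in (_ + (1 * X)%:E)%E]big1 => [|j _]; last first.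
      have -> : x j = pr d (enum_val j) by rewrite prd enum_valK.
      rewrite indicE mem_set//= in_itv/= /lo /hi /pr' valK -ler_distl.
      rewrite (le_trans (pr_lip _ _ _))// (cdist_le_cdiam _ _ _ _ (dE i))//.
      by apply: Hctr; exists d.
    rewrite mul1r leeDr// sume_ge0// => j _; rewrite lee_fin mulr_ge0//.
    by rewrite prodr_ge0.
  rewrite -(big_mkord xpredT (fun i => (c i * \prod_(j < #|T|) \1_`[lo i j, hi i j] (x j))%:E)).
  apply: nneseries_lim_ge => k _ _.
  by rewrite lee_fin mulr_ge0// prodr_ge0.
move=> one_le lt_e.
have : (\sum_(i <oo) (c i * \prod_(j < #|T|) (hi i j - lo i j))%:E <=
    \sum_(i <oo) ((2 ^+ #|T|)%:E * hcost s (E i)))%E.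
  apply: lee_nneseries => [i _ _|i _].
    rewrite lee_fin mulr_ge0// prodr_ge0// => j _.
    by rewrite /lo /hi subr_ge0 lerD2l ge0_cp.
  rewrite /c /hcost; case: pselect => [E0|E0]; first by rewrite mul0r mule0.
  rewrite (eq_bigr (fun=> 2 * cdiam (E i))) => [|j _]; last by rewrite /lo /hi; ring.
  rewrite mul1r prodr_const card_ord exprMn -EFinM lee_fin ler_wpM2l ?exprn_ge0//.
  (* Comparing powers needs a positive base; at diameter 0 the left side vanishes because
     [0 <= s < #|T|]. *)
  have [->|ci0] := eqVneq (cdiam (E i)) 0.
    have T0 : (0 < #|T|)%N by rewrite -(ltr_nat R) (le_lt_trans s0 sT).
    by rewrite expr0n gtn_eqF// powR_ge0.
  rewrite -powR_mulrn// ger_powR ?(ltW sT)// lt_neqAle eq_sym ci0 diam_ge0/=.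
  by apply: (cdiam_le _ _ _ (dE i)); exact/set0P/eqP.
rewrite nneseriesZl; last by move=> i _; exact: hcost_ge0.
move=> /(le_trans one_le); apply/negP; rewrite -ltNge.
by rewrite muleC -lte_pdivlMr ?exprn_gt0// mul1e.
Qed.

End LowerBound.

(** * Pivot columns *)

Section Matrices.
Context {R : realType}.

(** If [v *m A = 0] with [v] nonzero, the column at an entry of [v] of largest absolute value
    contradicts dominance. *)
Lemma column_dominant_unitmx (k : nat) (A : 'M[R]_k) :
  (forall b, \sum_(a | a != b) `|A a b| < `|A b b|) -> A \in unitmx.
Proof.
move=> dom; rewrite -row_free_unit; apply: inj_row_free => v vA0.
apply/eqP; apply: contraT => /rV0Pn[b0 vb0].
have [b _ bmax] := @Order.TotalTheory.arg_maxP _ _ _ b0 xpredT (fun b => `|v 0 b|) isT.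
have vb_gt0 : 0 < `|v 0 b|.
  by apply: lt_le_trans (bmax b0 isT); rewrite normr_gt0.
have /eqP : (v *m A) 0 b = 0 by rewrite vA0 mxE.
rewrite mxE (bigD1 b)//= addr_eq0 => /eqP /(congr1 Num.norm).
rewrite normrN normrM => eq_norm.
have : `|v 0 b| * `|A b b| <= `|v 0 b| * \sum_(a | a != b) `|A a b|.
  rewrite eq_norm mulr_sumr (le_trans (ler_norm_sum _ _ _))//.
  by apply: ler_sum => a _; rewrite normrM ler_wpM2r//; exact: bmax.
by rewrite ler_pM2l// leNgt dom.
Qed.

Context {m : nat}.
Implicit Types (J K : {set 'I_m}) (A B G Z : 'M[R]_m).

Definition coord_proj J : 'M[R]_m := diag_mx (\row_a (a \in J)%:R).

Lemma coord_proj_mulE J A a b : (coord_proj J *m A) a b = (a \in J)%:R * A a b.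
Proof. by rewrite mul_diag_mx !mxE. Qed.

Lemma mul_coord_projE J A a b : (A *m coord_proj J) a b = A a b * (b \in J)%:R.
Proof. by rewrite mul_mx_diag !mxE. Qed.

Lemma coord_projE J a b : coord_proj J a b = (a == b)%:R * (b \in J)%:R.
Proof. by rewrite -[coord_proj J]mul1mx mul_coord_projE mxE. Qed.

Lemma coord_projI J K : coord_proj J *m coord_proj K = coord_proj (J :&: K)%SET.
Proof.
apply/matrixP => a b; rewrite coord_proj_mulE !coord_projE finset.in_setI.
by have [->|] := eqVneq a b; rewrite ?mul0r ?mulr0// !mul1r -natrM mulnb.
Qed.

Lemma coord_projK J : coord_proj J *m coord_proj J = coord_proj J.
Proof. by rewrite coord_projI finset.setIid. Qed.

Lemma coord_proj0 : coord_proj finset.set0 = 0.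
Proof. by apply/matrixP => a b; rewrite coord_projE finset.in_set0 mulr0 mxE. Qed.

Lemma coord_projC J : coord_proj (~: J)%SET = 1%:M - coord_proj J.
Proof.
apply/matrixP => a b; rewrite !mxE finset.in_setC.
by have [->|] := eqVneq a b; case: (_ \in J); rewrite ?subr0 ?subrr.
Qed.

Lemma coord_proj_disjoint J K : (J :&: K)%SET = finset.set0 ->
  coord_proj J *m coord_proj K = 0.
Proof. by rewrite coord_projI => ->; exact: coord_proj0. Qed.

(* [G] is the projection along [ker A] onto the coordinate subspace of a set of
   pivot columns of [A], i.e. its reduced row echelon form. *)
Lemma pivot_columns A : exists J G,
  [/\ #|J| = \rank A, A *m G = A, forall B, A *m B = 0 -> G *m B = 0,
      G *m coord_proj J = coord_proj J & coord_proj J *m G = G].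
Proof.
(* A maximal free family of rows of [A^T] gives the pivot columns [f] of [A]; [Y] expresses all
   columns in them. *)
rewrite -mxrank_tr; set r := \rank A^T; pose f := maxrankfun A^T.
have f_inj : injective f by exact: maxrankfun_inj.
have [Y AY] : exists Y : 'M[R]_(r, m), A = colsub f A *m Y.
  have /submxP[Y AY] : (A^T <= rowsub f A^T)%MS by rewrite eq_maxrowsub.
  exists Y^T; apply: trmx_inj; rewrite trmx_mul trmxK [LHS]AY; congr (_ *m _).
  by apply/matrixP => a b; rewrite !mxE.
have colsub_inj k (B : 'M[R]_(r, k)) : colsub f A *m B = 0 -> B = 0.
  move=> /(congr1 trmx); rewrite trmx_mul trmx0 => AB0.
  apply: trmx_inj; rewrite trmx0.
  have /row_free_inj : row_free (rowsub f A^T) by exact: maxrowsub_free.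
  apply; rewrite mul0mx -AB0; congr (_ *m _).
  by apply/matrixP => a b; rewrite !mxE.
(* [S] is the inclusion of the pivot coordinates and a right inverse of [Y], so [S *m Y] is the
   projection sought. *)
pose S : 'M[R]_(m, r) := \matrix_(a, k) (a == f k)%:R.
have AS : A *m S = colsub f A.
  apply/matrixP => a k; rewrite !mxE (bigD1 (f k))//= mxE eqxx mulr1 big1 ?addr0//.
  by move=> b bk; rewrite mxE (negbTE bk) mulr0.
have YS : Y *m S = 1%:M.
  apply/eqP; rewrite -subr_eq0; apply/eqP/colsub_inj.
  by rewrite mulmxBr mulmxA -[colsub _ _ *m _]AY AS mulmx1 subrr.
pose J := finset.imset (fun k : 'I_r => f k) (mem 'I_r).
have SS : S *m S^T = coord_proj J.
  apply/matrixP => a b; rewrite coord_projE mxE.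
  have [/imsetP[k _ ->]|bJ] := boolP (b \in J).
    rewrite (bigD1 k)//= !mxE eqxx mulr1 big1 ?addr0 ?mulr1// => l lk.
    by rewrite !mxE (inj_eq f_inj) [k == l]eq_sym (negbTE lk) mulr0.
  rewrite mulr0 big1// => k _; rewrite !mxE.
  have [bk|] := eqVneq b (f k); last by rewrite mulr0.
  by rewrite bk imset_f in bJ.
exists J, (S *m Y); split.
- by rewrite card_imset// card_ord.
- by rewrite mulmxA AS; exact: esym AY.
- move=> B; rewrite [X in X *m _]AY -!mulmxA => /colsub_inj ->.
  by rewrite mulmx0.
- by rewrite -SS mulmxA -[S *m Y *m S]mulmxA YS mulmx1.
- rewrite -SS mulmxA -[S *m S^T *m S]mulmxA (_ : S^T *m S = 1%:M) ?mulmx1//.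
  apply/matrixP => k l; rewrite !mxE (bigD1 (f k))//= !mxE eqxx mul1r.
  rewrite (inj_eq f_inj) big1 ?addr0// => a ak.
  by rewrite !mxE (negbTE ak) mul0r.
Qed.

End Matrices.

(** * Parametrization of the rank strata *)

Section ExtendByZero.
Context {R : realType} {I : finType} (B : {set I}).

(** Turns the free entries into full matrices: entries outside [B] are 0. *)
Definition extend0 (p : {t | t \in B} -> R) (t : I) : R :=
  if insub t is Some u then p u else 0.

Lemma extend0_lipschitz t : lipschitz_on_boxes (fun p => extend0 p t).
Proof.
rewrite /extend0; case: insub => [u|]; first exact: lipschitz_on_boxes_proj.
exact: lipschitz_on_boxes_cst.
Qed.

Lemma extend0_in p t (tB : t \in B) : extend0 p t = p (exist _ t tB).
Proof. by rewrite /extend0 insubT. Qed.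

Lemma extend0_restr (g : I -> R) : (forall t, t \notin B -> g t = 0) ->
  extend0 (fun u => g (val u)) =1 g.
Proof.
by move=> g0 t; rewrite /extend0; case: insubP => [u _ <-//|/g0 ->].
Qed.

End ExtendByZero.

Lemma sum_triple (I : finType) (m : nat) (F : I * 'I_m * 'I_m -> nat) :
  (\sum_t F t = \sum_i \sum_a \sum_b F (i, a, b))%N.
Proof. by rewrite !pair_bigA; apply: eq_bigr => -[[]]. Qed.

Lemma sum_and (m : nat) (P Q : pred 'I_m) :
  (\sum_a \sum_b (if P a && Q b then 1 else 0) = #|P| * #|Q|)%N.
Proof.
rewrite -!sum1_card [RHS]big_distrlr/= [RHS]big_mkcond/=; apply: eq_bigr => a _.
rewrite [in RHS]big_mkcond/= unfold_in; case: (P a) => //=.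
by rewrite big1.
Qed.

Lemma card_notin (m : nat) (J : {set 'I_m}) : #|[pred a | a \notin J]| = (m - #|J|)%N.
Proof. by rewrite -[X in (X - _)%N]card_ord -(cardC (mem J)) addKn. Qed.

Section Strata.
Context {R : realType} {n m : nat}.
Local Notation cfg := (cfg R n m).
Local Notation pivots := {ffun 'I_n.+1 -> {set 'I_m}}.
Implicit Types (J : pivots).

(** The index [i] of [d i] is shifted: it maps degree [i + 1] to degree [i]. *)
Definition src (i : 'I_n) : 'I_n.+1 := lift ord0 i.
Definition tgt (i : 'I_n) : 'I_n.+1 := widen_ord (leqnSn n) i.

(** The left summand holds the free entries of the [U_i], the right one those of the [X_k]. *)
Definition stratum_index J : {set 'I_n * 'I_m * 'I_m + 'I_n.+1 * 'I_m * 'I_m} :=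
  finset (fun t => match t with
    | inl (i, a, b) => (a \notin J (tgt i)) && (b \in J (src i))
    | inr (k, a, b) => (a \in J k) && (b \notin J k)
    end).

Lemma card_stratum_index J : #|stratum_index J| =
  (\sum_(i < n) (m - #|J (tgt i)|) * #|J (src i)| +
   \sum_(k < n.+1) #|J k| * (m - #|J k|))%N.
Proof.
by rewrite -sum1_card big_mkcond big_sumType/=; congr addn;
  rewrite sum_triple; apply: eq_bigr => i _;
  under eq_bigr do under eq_bigr do rewrite finset.inE;
  rewrite sum_and ?card_notin.
Qed.

Definition stratum_param J (p : {t | t \in stratum_index J} -> R) : cfg :=
  let U i := \matrix_(a, b) extend0 p (inl (i, a, b)) : 'M[R]_m in
  let X k := \matrix_(a, b) extend0 p (inr (k, a, b)) : 'M[R]_m in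
  fun i => (coord_proj (~: J (tgt i))%SET - X (tgt i)) *m U i *m
           (coord_proj (J (src i)) + X (src i)).

Lemma stratum_param_lipschitz J i a b :
  lipschitz_on_boxes (fun p => @stratum_param J p i a b).
Proof.
rewrite /stratum_param/=; apply: lipschitz_on_boxes_mulmx => {a b} a b.
  apply: lipschitz_on_boxes_mulmx => {a b} a b; last first.
    rewrite (_ : (fun p => _) = fun p => extend0 p (inl (i, a, b))); last first.
      by apply/funext => p; rewrite mxE.
    exact: extend0_lipschitz.
  rewrite (_ : (fun p => _) = fun p => coord_proj (~: J (tgt i))%SET a b +
      (-1) * extend0 p (inr (tgt i, a, b))); last first.
    by apply/funext => p; rewrite !mxE mulN1r.
  apply: lipschitz_on_boxesD; first exact: lipschitz_on_boxes_cst.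
  apply: lipschitz_on_boxesM; first exact: lipschitz_on_boxes_cst.
  exact: extend0_lipschitz.
rewrite (_ : (fun p => _) = fun p => coord_proj (J (src i)) a b +
    extend0 p (inr (src i, a, b))); last by apply/funext => p; rewrite !mxE.
apply: lipschitz_on_boxesD; first exact: lipschitz_on_boxes_cst.
exact: extend0_lipschitz.
Qed.

(** Let [G k] be the pivot projection of the map leaving degree [k]. Then [d i *m G (src i) = d i],
    and the complex condition gives [G (tgt i) *m d i = 0]. With [X = G - P] and [U = Q d P] the
    product is [(1 - G) Q d P G = (1 - G) d = d]. *)
Lemma stratum_param_surj (d : cfg) : chain_complexes d ->
  exists J, [/\ J ord0 = finset.set0, forall i, #|J (src i)| = \rank (d i) &
    range (@stratum_param J) d].
Proof.
move=> dd0.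
have /choice[JG HJG] i : exists JG : {set 'I_m} * 'M[R]_m,
  [/\ #|JG.1| = \rank (d i), d i *m JG.2 = d i,
      forall B : 'M[R]_m, d i *m B = 0 -> JG.2 *m B = 0,
      JG.2 *m coord_proj JG.1 = coord_proj JG.1 & coord_proj JG.1 *m JG.2 = JG.2].
  by have [J [G H]] := pivot_columns (d i); exists (J, G).
(* No [d i] leaves degree 0, so there the pivot set is empty and the projection is 0. *)
pose J : pivots := [ffun k => if unlift ord0 k is Some i then (JG i).1 else finset.set0].
pose G k : 'M[R]_m := if unlift ord0 k is Some i then (JG i).2 else 0.
have J0 : J ord0 = finset.set0 by rewrite ffunE unlift_none.
have Jsrc i : J (src i) = (JG i).1 by rewrite ffunE liftK.
have Gsrc i : G (src i) = (JG i).2 by rewrite /G liftK.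
have GP k : G k *m coord_proj (J k) = coord_proj (J k).
  rewrite /G ffunE; case: unliftP => [i _|_]; first by have [] := HJG i.
  by rewrite coord_proj0 mul0mx.
have PG k : coord_proj (J k) *m G k = G k.
  rewrite /G ffunE; case: unliftP => [i _|_]; first by have [] := HJG i.
  by rewrite coord_proj0 mul0mx.
have dG i : d i *m G (src i) = d i by rewrite Gsrc; have [] := HJG i.
have Gd i : G (tgt i) *m d i = 0.
  rewrite /G; case: unliftP => [j tij|_]; last exact: mul0mx.
  have [_ _ + _ _] := HJG j; apply; apply: dd0.
  by have /(congr1 val) := tij; rewrite /= /bump add1n.
exists J; split=> // [i|]; first by rewrite Jsrc; have [] := HJG i.
pose g t : R := match t with
  | inl (i, a, b) => (coord_proj (~: J (tgt i))%SET *m d i *m coord_proj (J (src i))) a b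
  | inr (k, a, b) => (G k - coord_proj (J k)) a b
  end.
(* Rows of [X] lie in [J k] and columns outside it, so dropping the entries that are not free loses
   nothing. *)
have XE k : G k - coord_proj (J k) =
    coord_proj (J k) *m (G k - coord_proj (J k)) *m coord_proj (~: J k)%SET.
  rewrite mulmxBr PG coord_projK coord_projC mulmxBr mulmx1 mulmxBl GP.
  by rewrite coord_projK subrr subr0.
exists (fun u => g (val u)) => //.
have ext : extend0 (fun u : {t | t \in stratum_index J} => g (val u)) =1 g.
  apply: extend0_restr => -[[[i a] b]|[[k a] b]]; rewrite finset.inE => /negP ab0.
    rewrite /g mul_coord_projE coord_proj_mulE finset.in_setC.
    case: (a \notin _) (b \in _) ab0 => -[] // _; by rewrite ?mul0r ?mulr0.
  rewrite /g XE mul_coord_projE coord_proj_mulE finset.in_setC.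
  by case: (a \in _) (b \notin _) ab0 => -[] // _; rewrite ?mul0r ?mulr0.
apply/funext => i; rewrite /stratum_param/=.
set U := (X in _ *m X *m _).
have -> : U = coord_proj (~: J (tgt i))%SET *m d i *m coord_proj (J (src i)).
  by apply/matrixP => a b; rewrite mxE ext.
have XM k : \matrix_(a, b)
    extend0 (fun u : {t | t \in stratum_index J} => g (val u)) (inr (k, a, b)) =
    G k - coord_proj (J k).
  by apply/matrixP => a b; rewrite mxE ext.
rewrite !XM [X in _ *m X](_ : _ = G (src i)); last by rewrite addrC subrK.
rewrite -!mulmxA PG dG !mulmxA.
rewrite coord_projC (_ : _ - _ - _ = 1%:M - G (tgt i)); last first.
  by rewrite opprB addrA subrK.
rewrite -mulmxA mulmxBl mul1mx mulmxBl mul1mx mulmxBr Gd sub0r opprK.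
by rewrite mulmxA GP subrK.
Qed.

End Strata.

(** * Complexes with prescribed entries *)

Lemma card_ord_lt (m r : nat) : (r <= m)%N -> #|[pred a : 'I_m | (a < r)%N]| = r.
Proof.
move=> rm; rewrite -sum1_card -[RHS]card_ord -sum1_card.
by rewrite [RHS](big_ord_widen m (fun=> 1%N)).
Qed.

Lemma card_ord_ge (m r : nat) : (r <= m)%N ->
  #|[pred a : 'I_m | (m - r <= a)%N]| = r.
Proof.
move=> rm; have := cardC [pred a : 'I_m | (a < m - r)%N].
rewrite card_ord card_ord_lt ?leq_subr//; set c := #|_| => mc.
transitivity c; last by lia.
by apply: eq_card => a; rewrite !inE -leqNgt.
Qed.

Section ComplexesOfRank.
Context {R : realType} {n m : nat}.
Local Notation cfg := (cfg R n m).
Variable r : nat -> nat.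
Hypothesis rr : forall i, (i < n)%N -> (r i + r i.+1 <= m)%N.

(* Alternating between the first and the last [r k] coordinates makes
   consecutive sets disjoint. *)
Definition pivot_set (k : nat) : {set 'I_m} :=
  finset (fun a : 'I_m => if odd k then (m - r k <= a)%N else (a < r k)%N).

Lemma card_pivot_set k : (r k <= m)%N -> #|pivot_set k| = r k.
Proof.
move=> rkm; rewrite cardsE; case: (odd k); [exact: card_ord_ge|exact: card_ord_lt].
Qed.

Lemma pivot_set_disjoint k : (k < n)%N ->
  (pivot_set k :&: pivot_set k.+1)%SET = finset.set0.
Proof.
move=> /rr rk; apply/finset.setP => a; rewrite !finset.inE/=.
by case: (odd k) => /=; lia.
Qed.

(** Two blocks of [d i]: rows off [J_i] with columns in [J_(i+1)], and rows in [J_(i+1)] with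
    columns off it. Disjointness of consecutive pivot sets puts the latter rows off [J_i] too. *)
Definition complex_index : {set 'I_n * 'I_m * 'I_m} :=
  finset (fun t : 'I_n * 'I_m * 'I_m => let: (i, a, b) := t in (a \notin pivot_set i) &&
    ((b \in pivot_set i.+1) || (a \in pivot_set i.+1))).

Lemma pivot_setSN i a : (i < n)%N -> a \in pivot_set i.+1 -> a \notin pivot_set i.
Proof.
move=> /pivot_set_disjoint/finset.setP/(_ a); rewrite finset.in_setI finset.in_set0.
by move=> + aS; rewrite aS andbT => ->.
Qed.

Lemma card_complex_index : #|complex_index| =
  (\sum_(i < n) ((m - r i) * r i.+1 + r i.+1 * (m - r i.+1)))%N.
Proof.
rewrite -sum1_card big_mkcond sum_triple; apply: eq_bigr => i _.
have := rr (ltn_ord i) => rri.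
have <- : #|pivot_set i| = r i by apply: card_pivot_set; lia.
have <- : #|pivot_set i.+1| = r i.+1 by apply: card_pivot_set; lia.
rewrite -!card_notin -!sum_and -big_split/=; apply: eq_bigr => a _.
rewrite -big_split/=; apply: eq_bigr => b _; rewrite finset.inE.
have memE c : pred_of_set (pivot_set i.+1) c = (c \in pivot_set i.+1) by [].
rewrite !memE; have := @pivot_setSN i a (ltn_ord i).
case: (a \in pivot_set i.+1) (a \in pivot_set i) (b \in _) => -[] [] //= aI.
by have := aI isT.
Qed.

Local Notation P k := (@coord_proj R m (pivot_set k)).
Local Notation Q k := (@coord_proj R m (~: pivot_set k)%SET).

(** * The complex with given values of the prescribed entries *)

Section Fiber.
Variable z : {t | t \in complex_index} -> R.
Hypothesis z01 : forall t, 0 <= z t <= 1.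

(** Shifting the diagonal by [m + 1] while the other entries stay in [[0, 1]] makes the pivot block,
    completed by the identity to [A i], column dominant and hence invertible. *)
Let Z (i : 'I_n) : 'M[R]_m :=
  \matrix_(a, b) (m.+1%:R * (a == b)%:R + extend0 z (i, a, b)).
Let A (i : 'I_n) : 'M[R]_m := P i.+1 *m Z i *m P i.+1 + Q i.+1.
(** The solution of [A X = P Z Q], which forces the second block of prescribed entries. In degree
    [k'.+1] the matrix used is the one of index [k']. *)
Let X (k : nat) : 'M[R]_m :=
  if k is k'.+1 then
    if insub k' is Some i then invmx (A i) *m (P k *m Z i *m Q k) else 0
  else 0.
Let G (k : nat) : 'M[R]_m := P k + X k.

Definition complex_of_coords : cfg := fun i =>
  (1%:M - G i) *m (Q i *m Z i *m P i.+1) *m G i.+1.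

Let A_unit i : A i \in unitmx.
Proof.
apply: column_dominant_unitmx => b.
have e01 a : 0 <= extend0 z (i, a, b) <= 1.
  by rewrite /extend0; case: insub => [u|]; rewrite ?z01// lexx ler01.
have AE a : A i a b = (a \in pivot_set i.+1)%:R * Z i a b * (b \in pivot_set i.+1)%:R
    + (a == b)%:R * (b \notin pivot_set i.+1)%:R.
  by rewrite mxE mul_coord_projE coord_proj_mulE coord_projE finset.in_setC.
have [bJ|bJ] := boolP (b \in pivot_set i.+1); last first.
  rewrite big1 => [|a ab]; rewrite AE (negbTE bJ) mulr0 add0r.
    by rewrite eqxx mulr1 normr1 ltr01.
  by rewrite (negbTE ab) mul0r normr0.
apply: (@le_lt_trans _ _ (\sum_(a < m | a != b) 1)).
  apply: ler_sum => a ab; rewrite AE bJ !mulr1 mulr0 addr0.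
  rewrite mxE (negbTE ab) mulr0 add0r; have /andP[? ?] := e01 a.
  by case: (a \in _); rewrite ?mul1r ?mul0r ?normr0 ?ler01// ger0_norm.
rewrite sumr_const; apply: (@le_lt_trans _ _ m%:R).
  by rewrite ler_nat -[leqRHS]card_ord max_card.
rewrite AE bJ !mulr1 mulr0 addr0 mul1r mxE eqxx mulr1; have /andP[? ?] := e01 b.
by rewrite ger0_norm ?addr_ge0// -natr1; lra.
Qed.

Let QE k : Q k = 1%:M - P k. Proof. exact: coord_projC. Qed.
Let PQ k : P k *m Q k = 0.
Proof. by rewrite QE mulmxBr mulmx1 coord_projK subrr. Qed.
Let QP k : Q k *m P k = 0.
Proof. by rewrite QE mulmxBl mul1mx coord_projK subrr. Qed.
Let XP k : X k *m P k = 0.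
Proof.
case: k => [|k]; rewrite /X; first by rewrite mul0mx.
by case: insub => [i|]; rewrite ?mul0mx// -!mulmxA QP !mulmx0.
Qed.
Let PX k : P k *m X k = X k.
Proof.
case: k => [|k]; rewrite /X; first by rewrite mulmx0.
case: insubP => [i _ <-|_]; last by rewrite mulmx0.
have PA : P i.+1 *m A i = A i *m P i.+1.
  by rewrite mulmxDr mulmxDl PQ QP -!mulmxA coord_projK !mulmxA coord_projK.
have PV : P i.+1 *m invmx (A i) = invmx (A i) *m P i.+1.
  transitivity (invmx (A i) *m (A i *m P i.+1) *m invmx (A i)).
    by rewrite mulKmx// A_unit.
  by rewrite -PA mulmxA mulmxK// A_unit.
have PPZ : P i.+1 *m (P i.+1 *m Z i *m Q i.+1) = P i.+1 *m Z i *m Q i.+1.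
  by rewrite !mulmxA coord_projK.
by rewrite mulmxA PV -[LHS]mulmxA PPZ.
Qed.
Let GP k : G k *m P k = P k. Proof. by rewrite mulmxDl coord_projK XP addr0. Qed.
Let PG k : P k *m G k = G k. Proof. by rewrite mulmxDr coord_projK PX. Qed.
Let GG k : G k *m (1%:M - G k) = 0.
Proof. by rewrite mulmxBr mulmx1 -{3}PG mulmxA GP PG subrr. Qed.

(** Consecutive maps meet in the factor [G (1 - G)], which is 0 because [G] is idempotent. *)
Lemma complex_of_coords_complex : chain_complexes complex_of_coords.
Proof.
move=> i j ij; rewrite /complex_of_coords ij.
by rewrite -!mulmxA [G i.+1 *m _]mulmxA GG mul0mx !mulmx0.
Qed.

(** On the first block [Q_i G_i = 0] and [G P = P] leave [Q Z P]. On the second, disjointness gives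
    [P_(i+1) G_i = 0], which leaves [P Z P X = A X = P Z Q]. *)
Lemma complex_of_coordsE t :
  (let: (i, a, b) := val t in complex_of_coords i a b - m.+1%:R * (a == b)%:R)
  = z t.
Proof.
case: t => -[[i a] b] /= tI; have := tI; rewrite finset.inE => /andP[aNi bOa].
have ZE : Z i a b - m.+1%:R * (a == b)%:R = z (exist _ (i, a, b) tI).
  by rewrite mxE addrAC subrr add0r extend0_in.
rewrite -ZE; congr (_ - _).
have QG : Q i *m G i = 0 by rewrite -PG mulmxA QP mul0mx.
have QQ k : Q k *m Q k = Q k by rewrite coord_projK.
case bJ : (b \in pivot_set i.+1) bOa => /=.
  move=> _; have : (Q i *m complex_of_coords i *m P i.+1) a b = (Q i *m Z i *m P i.+1) a b.
    rewrite /complex_of_coords -!mulmxA GP !mulmxA mulmxBr mulmx1 QG subr0 QQ.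
    by rewrite -[_ *m P i.+1 *m P i.+1]mulmxA coord_projK.
  by rewrite !mul_coord_projE !coord_proj_mulE finset.in_setC aNi bJ !mul1r !mulr1.
move=> aJ.
have PP : P i.+1 *m P i = 0.
  by apply: coord_proj_disjoint; rewrite finset.setIC; exact: pivot_set_disjoint.
have PG0 : P i.+1 *m G i = 0 by rewrite -PG mulmxA PP mul0mx.
have PQi : P i.+1 *m Q i = P i.+1 by rewrite QE mulmxBr mulmx1 PP subr0.
have GQ : G i.+1 *m Q i.+1 = X i.+1.
  by rewrite QE mulmxBr mulmx1 GP /G addrAC subrr add0r.
have QX : Q i.+1 *m X i.+1 = 0 by rewrite -PX mulmxA QP mul0mx.
have : (P i.+1 *m complex_of_coords i *m Q i.+1) a b = (P i.+1 *m Z i *m Q i.+1) a b.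
  rewrite /complex_of_coords -!mulmxA GQ !mulmxA mulmxBr mulmx1 PG0 subr0 PQi.
  transitivity ((A i *m X i.+1) a b).
    by rewrite /A mulmxDl QX addr0.
  by rewrite /X valK mulmxA mulmxV ?A_unit// mul1mx.
by rewrite !mul_coord_projE !coord_proj_mulE finset.in_setC aJ bJ !mul1r !mulr1.
Qed.

End Fiber.

Lemma chain_complexes_dim_ge (s : R) : 0 <= s ->
  hausdorff s (@chain_complexes R n m) = 0%E ->
  (\sum_(i < n) ((m - r i) * r i.+1 + r i.+1 * (m - r i.+1)))%:R <= s.
Proof.
move=> s0; rewrite -card_complex_index -card_sig.
apply: (@hausdorff0_dim_ge _ _ _ {t | t \in complex_index} (fun d t =>
  let: (i, a, b) := val t in d i a b - m.+1%:R * (a == b)%:R)) s0.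
- by move=> d e [[[i a] b] ?] /=; rewrite opprB addrA subrK; exact: le_entry_cdist.
- move=> z z01; exists (complex_of_coords z); first exact: complex_of_coords_complex.
  by move=> t; exact: complex_of_coordsE.
Qed.

End ComplexesOfRank.

(** * Borel measurability of the ranks *)

Section RankBorel.
Context {R : realType} {n m : nat}.
Local Notation cfg := (cfg R n m).

(** Lower semicontinuity of the rank: if [L *m x i *m M] is the identity of size [r], then for [y]
    close to [x] the matrix [L *m y i *m M] is still column dominant, so [y i] has rank at least
    [r]. *)
Lemma copen_rank_ge (i : 'I_n) (k : nat) :
  copen [set d : cfg | (k <= \rank (d i))%N].
Proof.
move=> x /= kx; set r := \rank (x i) in kx.
have [L [M LxM]] : exists (L : 'M[R]_(r, m)) (M : 'M[R]_(m, r)), L *m x i *m M = 1%:M.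
  have /row_fullP[L LC] := col_base_full (x i).
  have /row_freeP[M RM] := row_base_free (x i).
  by exists L, M; rewrite -(mulmx_base (x i)) mulmxA LC mul1mx.
pose K := \sum_a \sum_b \sum_d \sum_c `|L a c| * `|M d b|.
have K0 : 0 <= K by repeat apply: sumr_ge0 => ? _; rewrite mulr_ge0.
(* Each entry then moves by at most [1 / (2 (r + 1))], so the deviations in one column total at most
   1/2. *)
pose e := ((K + 1) * (2 * r.+1%:R))^-1.
have e0 : 0 < e by rewrite invr_gt0 !mulr_gt0// ltr_wpDl.
exists e => // y xy; rewrite (leq_trans kx)//.
pose B := L *m y i *m M.
have BE : B = 1%:M + L *m (y i - x i) *m M.
  by rewrite mulmxBr mulmxBl LxM subrKC.
have dB a b : `|(L *m (y i - x i) *m M) a b| <= (2 * r.+1%:R)^-1.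
  apply: (@le_trans _ _ (K * e)).
    apply: (@le_trans _ _ (\sum_d \sum_c `|L a c| * `|M d b| * e)).
      rewrite mxE (le_trans (ler_norm_sum _ _ _))//; apply: ler_sum => d _.
      rewrite normrM mxE -mulr_suml -mulr_suml -mulrA [`|M d b| * e]mulrC mulrA ler_wpM2r//.
      rewrite mulr_suml (le_trans (ler_norm_sum _ _ _))//; apply: ler_sum => c _.
      rewrite normrM ler_wpM2l// !mxE -normrN opprB.
      exact/ltW/(le_lt_trans (le_entry_cdist _ _ _ _ _) xy).
    rewrite (eq_bigr (fun d => (\sum_c `|L a c| * `|M d b|) * e)); last first.
      by move=> d _; rewrite mulr_suml.
    rewrite -mulr_suml ler_wpM2r ?(ltW e0)// /K.
    rewrite [leRHS](bigD1 a)//= [X in _ <= X + _](bigD1 b)//= -addrA lerDl.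
    by rewrite addr_ge0//; repeat apply: sumr_ge0 => ? _; rewrite mulr_ge0.
  rewrite /e invfM mulrA ler_piMl//.
  by rewrite ler_pdivrMr ?mul1r ?lerDl// ltr_wpDl.
have B_unit : B \in unitmx.
  apply: column_dominant_unitmx => b.
  apply: (@le_lt_trans _ _ (\sum_(a < r | a != b) (2 * r.+1%:R)^-1)).
    apply: ler_sum => a ab; rewrite BE mxE [X in X + _]mxE (negbTE ab) add0r.
    exact: dB.
  apply: (@lt_le_trans _ _ (1 - (2 * r.+1%:R)^-1)); last first.
    rewrite BE mxE [1%:M b b]mxE eqxx.
    by rewrite (le_trans _ (lerB_normD _ _))// normr1 lerB.
  rewrite ltrBrDr (le_lt_trans (y := r.+1%:R * (2 * r.+1%:R)^-1))//.
    rewrite sumr_const -mulrSr [leRHS]mulr_natl ler_wpMn2l//.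
    by rewrite ltnS -[leqRHS]card_ord max_card.
  by rewrite invfM mulrCA mulfV// mulr1 invf_lt1 ?ltr1n.
have := mxrank_unit B_unit; rewrite /B => <-.
by rewrite (leq_trans (mxrankM_maxl _ _))// mxrankM_maxr.
Qed.

(** Only finitely many rank vectors occur, and each is attained on a finite intersection of
    differences of open sets. *)
Lemma cborel_rank_pred (P : ('I_n -> nat) -> Prop) :
  cborel [set d : cfg | P (fun i => \rank (d i))].
Proof.
pose T := g_sigma_algebraType (@copen R n m); pose M := @measurable _ T.
suff : M [set d : cfg | P (fun i => \rank (d i))] by [].
have Mge i k : M [set d : cfg | (k <= \rank (d i))%N].
  by apply: sub_sigma_algebra; exact: copen_rank_ge.
have Meq i k : M [set d : cfg | \rank (d i) = k].
  rewrite (_ : [set d | _] = [set d : cfg | (k <= \rank (d i))%N] `\`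
      [set d : cfg | (k.+1 <= \rank (d i))%N]); 
    first exact: (@measurableD _ T _ _ (Mge i k) (Mge i k.+1)).
  apply/seteqP; split=> d /= => [->|[kr /negP]]; first by rewrite ltnn.
  by rewrite -leqNgt => rk; apply/eqP; rewrite eqn_leq rk.
rewrite (_ : [set d | _] = 
    \bigcup_(rho in [set rho : {ffun 'I_n -> 'I_m.+1} | P (fun i => rho i)])
    \bigcap_(i in [set: 'I_n]) [set d : cfg | \rank (d i) = rho i]); last first.
  apply/seteqP; split=> [d Pd|d [rho /= Prho drho]] /=.
    have ranklt i : (\rank (d i) < m.+1)%N by rewrite ltnS rank_leq_row.
    have rhoE : (fun i => nat_of_ord ([ffun i => Ordinal (ranklt i)] i)) = fun i => \rank (d i).
      by apply/funext => i; rewrite ffunE.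
    exists [ffun i => Ordinal (ranklt i)]; first by rewrite /= rhoE.
    by move=> i _; rewrite /= ffunE.
  by rewrite (_ : (fun i => _) = fun i => nat_of_ord (rho i))//; apply/funext => i; exact: drho.
apply: (@fin_bigcup_measurable _ T); first exact: finite_finset.
by move=> rho _; apply: (@fin_bigcap_measurable _ T) => [|i _]; [exact: finite_finset|exact: Meq].
Qed.

End RankBorel.

(** * Dimensions of the rank strata *)

Section RankProfiles.
Local Open Scope nat_scope.
Implicit Types (r : nat -> nat) (n m h k : nat).

Definition stratum_dim n m r : nat :=
  \sum_(i < n) ((m - r i) * r i.+1 + r i.+1 * (m - r i.+1)).

Definition rank_profile n m r : Prop :=
  [/\ r 0 = 0, r n.+1 = 0 & forall i, i <= n -> r i + r i.+1 <= m].

Lemma stratum_dim_betti n m r : rank_profile n m r ->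
  2 * stratum_dim n m r + \sum_(i < n.+1) (m - r i - r i.+1) ^ 2 = n.+1 * m ^ 2.
Proof.
move=> [r0 rn rr].
(* Induction on the truncated complex, whose last Betti number is [m - r N]. *)
suff : forall N, N <= n -> 2 * stratum_dim N m r +
    \sum_(i < N) (m - r i - r i.+1) ^ 2 + (m - r N) ^ 2 = N.+1 * m ^ 2.
  by move=> /(_ n (leqnn n)) <-; rewrite big_ord_recr/= rn subn0 addnA.
elim=> [|N IH] Nn.
  by rewrite /stratum_dim !big_ord0 r0 subn0 muln0 !add0n mul1n.
have := IH (ltnW Nn); rewrite /stratum_dim !big_ord_recr/=.
have := rr N (ltnW Nn); move: (\sum_(i < N) _) (\sum_(i < N) _) => s t le_m e.
have [c mE] : exists c, m = r N + r N.+1 + c by exists (m - (r N + r N.+1)); lia.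
rewrite mE in e *.
rewrite (_ : r N + r N.+1 + c - r N - r N.+1 = c); last by lia.
rewrite (_ : r N + r N.+1 + c - r N = r N.+1 + c) in e *; last by lia.
rewrite (_ : r N + r N.+1 + c - r N.+1 = r N + c); last by lia.
by rewrite [RHS]mulSn -e; ring.
Qed.

Lemma sum_parity h (g : nat -> nat) :
  \sum_(i < h.*2.+1) g i = \sum_(k < h.+1) g k.*2 + \sum_(k < h) g k.*2.+1.
Proof.
elim: h => [|h IH]; first by rewrite !big_ord_recr !big_ord0/= addn0.
rewrite doubleS 2!big_ord_recr/= IH [in RHS]big_ord_recr/=.
rewrite [X in _ = _ + X]big_ord_recr/= doubleS; lia.
Qed.

Lemma euler_characteristic h m r : rank_profile h.*2 m r ->
  \sum_(k < h.+1) (m - r k.*2 - r k.*2.+1) =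
  m + \sum_(k < h) (m - r k.*2.+1 - r k.*2.+2).
Proof.
move=> [r0 rn rr].
(* The alternating sum telescopes up to the rank [r N.*2.+1], which vanishes for [N = h]. *)
suff : forall N, N <= h -> \sum_(k < N.+1) (m - r k.*2 - r k.*2.+1) + r N.*2.+1 =
  m + \sum_(k < N) (m - r k.*2.+1 - r k.*2.+2).
  by move=> /(_ h (leqnn h)); rewrite rn addn0.
elim=> [|N IH] Nh.
  by rewrite big_ord_recr !big_ord0/= double0 r0; have := rr 0 isT; rewrite r0; lia.
rewrite big_ord_recr [X in _ = _ + X]big_ord_recr/=; have := IH (ltnW Nh).
have := rr N.*2.+1 ltac:(lia); have := rr N.*2.+2 ltac:(lia).
by rewrite doubleS; move: (\sum_(k < _) _) (\sum_(k < _) _) => s t; lia.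
Qed.

(** Here [d = (b - q) (b - q - e)]: no integer lies strictly between [q] and [q + e], so it is
    nonnegative, and it vanishes only at these two values. *)
Lemma secant_sqr (q b : nat) (e : bool) : exists2 d,
  b ^ 2 + q * (q + e) = (2 * q + e) * b + d &
  d = 0 -> (b = q) \/ (b = q + e).
Proof.
have [bq|qb] := leqP b q.
  have [c ->] : exists c, q = b + c by exists (q - b); lia.
  exists (c * (c + e)); first by ring.
  by move=> /eqP; rewrite muln_eq0 addn_eq0 => /orP[|/andP[]] /eqP; lia.
have [c ->] : exists c, b = q + c.+1 by exists (b - q.+1); lia.
exists (c.+1 * (c.+1 - e)).
  have [f cE] : exists f, c.+1 = e + f by exists (c.+1 - e); case: e; lia.
  by rewrite cE addKn; ring.
by move=> /eqP; rewrite muln_eq0 /= => /eqP; lia.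
Qed.

Lemma secant_le_sqr (q b : nat) (e : bool) :
  (2 * q + e) * b <= b ^ 2 + q * (q + e).
Proof. by have [d -> _] := secant_sqr q b e; rewrite leq_addr. Qed.

Lemma secant_lt_sqr (q b : nat) (e : bool) : b <> q -> b <> q + e ->
  (2 * q + e) * b < b ^ 2 + q * (q + e).
Proof.
move=> bq bqe; have [d -> d0] := secant_sqr q b e.
by rewrite -[X in X < _]addn0 ltn_add2l lt0n; apply/eqP => /d0[].
Qed.

(** * Balanced even Betti numbers maximise the dimension *)

Section Balanced.
Variables h m : nat.

Definition balanced b : bool :=
  (b == m %/ h.+1) || (b == m %/ h.+1 + (0 < m %% h.+1)).

(* [slope * b - offset] is the line through the graph of [b ^ 2] at the balanced
   values: a tangent if [h.+1] divides [m], a secant otherwise. *)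
Let slope := 2 * (m %/ h.+1) + (0 < m %% h.+1).
Let offset := (m %/ h.+1) * (m %/ h.+1 + (0 < m %% h.+1)).

Let secant_le b : slope * b <= b ^ 2 + offset.
Proof. exact: secant_le_sqr. Qed.

Let secant_balanced b : balanced b -> b ^ 2 + offset = slope * b.
Proof. by rewrite /slope /offset => /orP[] /eqP ->; ring. Qed.

Let secant_lt b : ~~ balanced b -> slope * b < b ^ 2 + offset.
Proof. by rewrite negb_or => /andP[/eqP bq /eqP bqe]; exact: secant_lt_sqr. Qed.

(** With cuts [c_k = (k * m) %/ h.+1], the ranks are [c_k] in degree [2k] and [m - c_(k+1)] in
    degree [2k + 1]. Odd Betti numbers vanish and the even ones are the differences
    [c_(k+1) - c_k]. *)
Definition balanced_rank j : nat :=
  if odd j then m - (j./2.+1 * m) %/ h.+1 else (j./2 * m) %/ h.+1.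

Let balanced_rank_even k : balanced_rank k.*2 = (k * m) %/ h.+1.
Proof. by rewrite /balanced_rank odd_double doubleK. Qed.

Let balanced_rank_odd k : balanced_rank k.*2.+1 = m - (k.+1 * m) %/ h.+1.
Proof. by rewrite /balanced_rank /= odd_double/= uphalf_double. Qed.

Let cut_le k : k <= h.+1 -> (k * m) %/ h.+1 <= m.
Proof.
move=> kh; apply: (@leq_trans ((h.+1 * m) %/ h.+1)); last by rewrite mulKn.
by rewrite leq_div2r// leq_mul2r kh orbT.
Qed.

(** Adding [m] raises the quotient by [m %/ h.+1] plus a carry of 0 or 1; there is no carry when
    [h.+1] divides [m]. *)
Let cutS k : exists2 b, balanced b & (k.+1 * m) %/ h.+1 = (k * m) %/ h.+1 + b.
Proof.
rewrite mulSn divnD//.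
have [m0|m0] := posnP (m %% h.+1).
  exists (m %/ h.+1); first by rewrite /balanced eqxx.
  rewrite m0 add0n (_ : h.+1 <= _ = false); last by rewrite leqNgt ltn_pmod.
  by rewrite addn0 addnC.
exists (m %/ h.+1 + (h.+1 <= m %% h.+1 + (k * m) %% h.+1)).
  by rewrite /balanced m0; case: (h.+1 <= _); rewrite ?addn0 eqxx ?orbT.
by lia.
Qed.

Lemma balanced_rank_profile : rank_profile h.*2 m balanced_rank.
Proof.
split=> [||i ih].
- by rewrite /balanced_rank/= div0n.
- by rewrite balanced_rank_odd mulKn// subnn.
have ih2 : i./2 < h.+1 by rewrite ltnS -(doubleK h) half_leq.
have := cut_le ih2; have [ie|io] := boolP (odd i).
  rewrite -{2 3}(odd_double_half i) ie add1n -doubleS balanced_rank_odd balanced_rank_even.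
  by move: (_ %/ _) => S ?; rewrite subnK.
rewrite -{2 3}(odd_double_half i) (negbTE io) add0n balanced_rank_odd balanced_rank_even.
have [b _ ->] := cutS i./2; move: (_ %/ _) => S ?; lia.
Qed.

(** All even Betti numbers lie on the secant line, the odd ones vanish, and by the Euler
    characteristic the even ones sum to [m]. *)
Lemma balanced_rank_squares :
  \sum_(i < h.*2.+1) (m - balanced_rank i - balanced_rank i.+1) ^ 2 + h.+1 * offset
  = slope * m.
Proof.
rewrite (sum_parity h (fun i => (m - balanced_rank i - balanced_rank i.+1) ^ 2)).
have odd0 (k : 'I_h) : m - balanced_rank k.*2.+1 - balanced_rank k.*2.+2 = 0.
  rewrite -doubleS balanced_rank_odd balanced_rank_even.
  by rewrite subKn ?subnn// cut_le// ltnS ltnW.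
rewrite [X in _ + X + _]big1 => [|k _]; last by rewrite odd0.
have := euler_characteristic balanced_rank_profile.
rewrite [X in _ = _ + X]big1 => [|k _]; last by rewrite odd0.
rewrite !addn0 => euler; rewrite -[X in _ = _ * X]euler big_distrr/=.
rewrite -[X in _ + X * _](card_ord h.+1) -sum_nat_const.
rewrite -big_split/=; apply: eq_bigr => k _; apply: secant_balanced.
rewrite balanced_rank_even balanced_rank_odd.
have [b bb e] := cutS k; have := @cut_le k.+1 (ltn_ord k); rewrite e => le_m.
by rewrite (_ : _ - _ - _ = b)//; lia.
Qed.

(** Sum the secant inequality over the even degrees; it is strict at [k], and the even Betti numbers
    sum to at least [m]. *)
Lemma unbalanced_squares r k : rank_profile h.*2 m r -> k <= h ->
  ~~ balanced (m - r k.*2 - r k.*2.+1) ->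
  slope * m < \sum_(i < h.*2.+1) (m - r i - r i.+1) ^ 2 + h.+1 * offset.
Proof.
move=> rP kh unb; rewrite (sum_parity h (fun i => (m - r i - r i.+1) ^ 2)).
apply: (@leq_ltn_trans (slope * \sum_(k < h.+1) (m - r k.*2 - r k.*2.+1))).
  by rewrite (euler_characteristic rP) mulnDr leq_addr.
rewrite addnAC; apply: leq_trans (leq_addr _ _).
rewrite big_distrr/= -[X in _ + X * _](card_ord h.+1) -sum_nat_const -big_split/=.
have kh' : k < h.+1 by [].
rewrite (bigD1 (Ordinal kh'))//= [X in _ < X](bigD1 (Ordinal kh'))//=.
by rewrite -addSn leq_add ?secant_lt// leq_sum// => i _; exact: secant_le.
Qed.

(** Twice the dimension plus the sum of squares is constant, so more squares mean a smaller
    dimension. *)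
Lemma stratum_dim_unbalanced r k : rank_profile h.*2 m r -> k <= h ->
  ~~ balanced (m - r k.*2 - r k.*2.+1) ->
  stratum_dim h.*2 m r < stratum_dim h.*2 m balanced_rank.
Proof.
move=> rP kh unb; have := unbalanced_squares rP kh unb.
have := balanced_rank_squares.
have := stratum_dim_betti rP; have := stratum_dim_betti balanced_rank_profile.
by move: (\sum_(i < _) _) (\sum_(i < _) _) => s t; lia.
Qed.

Lemma balanced_floor_ceil (R : realType) b : balanced b ->
  b%:Z = Num.floor (m%:R / h.+1%:R : R)%R \/ b%:Z = Num.ceil (m%:R / h.+1%:R : R)%R.
Proof.
have h0 : (0 < h.+1%:R :> R)%R by rewrite ltr0n.
have mE : (m%:R = (m %/ h.+1)%:R * h.+1%:R + (m %% h.+1)%:R :> R)%R.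
  by rewrite -natrM -natrD -divn_eq.
have rem_lt : ((m %% h.+1)%:R < h.+1%:R :> R)%R by rewrite ltr_nat ltn_pmod.
move=> /orP[] /eqP ->.
  left; apply/esym/floor_def.
  rewrite intrD -!pmulrn ler_pdivlMr// ltr_pdivrMr// mE mulrDl mul1r.
  by rewrite lerDl ler0n ltrD2l.
have [m0|m0] := posnP (m %% h.+1).
  left; apply/esym/floor_def; rewrite addn0 intrD -!pmulrn.
  by rewrite ler_pdivlMr// ltr_pdivrMr// mE m0 mulrDl mul1r addr0 lexx ltrDl.
right; apply/esym/ceil_def.
rewrite [X in (X%:~R < _)%R](_ : _ = (m %/ h.+1)%:Z)%R; last by rewrite PoszD addrK.
rewrite -!pmulrn ltr_pdivlMr// ler_pdivrMr// mE ltrDl ltr0n m0/=.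
by rewrite natrD mulrDl mul1r lerD2l ltW.
Qed.

End Balanced.
End RankProfiles.

(** * Almost sure Betti numbers *)

Section RankDimension.
Context {R : realType} {n m : nat}.
Local Notation cfg := (cfg R n m).
Implicit Types (d : cfg).

Lemma crank_src d (i : 'I_n) : crank d i.+1 = \rank (d i).
Proof.
rewrite /crank (bigD1 i)//= big1 ?addn0// => j /andP[/eqP[ij] /eqP ji].
by exfalso; apply: ji; exact: val_inj.
Qed.

Lemma crank_profile d : chain_complexes d -> rank_profile n m (crank d).
Proof.
move=> dd0; have r0 : crank d 0 = 0%N by rewrite /crank big1.
have rn : crank d n.+1 = 0%N.
  by rewrite /crank big1// => i /eqP[ni]; have := ltn_ord i; rewrite ni ltnn.
have rm i : (crank d i <= m)%N.
  case: i => [|i]; first by rewrite r0.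
  have [in_|ni] := ltnP i n.
    by rewrite (crank_src d (Ordinal in_)) rank_leq_row.
  by rewrite /crank big1// => j /eqP[ji]; have := ltn_ord j; rewrite ji ltnNge ni.
split=> // -[_|i ni]; first by rewrite r0 rm.
have [iSn|] := ltnP i.+1 n; last first.
  by move=> nSi; rewrite (_ : i.+2 = n.+1) ?rn ?addn0 ?rm//; lia.
rewrite (crank_src d (Ordinal ni)) (crank_src d (Ordinal iSn)).
exact/mulmx0_rank_max/dd0.
Qed.

Lemma stratum_param_rank d : chain_complexes d ->
  exists J, #|stratum_index J| = stratum_dim n m (crank d) /\
    range (@stratum_param R n m J) d.
Proof.
move=> dd0; have [J [J0 Jr Jd]] := stratum_param_surj dd0.
exists J; split=> //; rewrite card_stratum_index big_ord_recl J0 cards0 mul0n add0n.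
rewrite -big_split/=; apply: eq_bigr => i _.
rewrite -/(src i) Jr crank_src; congr (_ * _ + _)%N; congr (_ - _)%N.
case: (unliftP ord0 (tgt i)) => [j tij|ti].
  rewrite tij Jr -crank_src; congr crank.
  by have := congr1 val tij; rewrite /= /bump add1n.
rewrite ti J0 cards0; have /= -> := congr1 val ti.
by case: (crank_profile dd0).
Qed.

(** [A] lies in the union of the images of those finitely many parametrizations with fewer than [s]
    parameters, each of them null. *)
Lemma hausdorff_small_strata (s : R) (A : set cfg) :
  (forall d, A d -> chain_complexes d /\ (stratum_dim n m (crank d))%:R < s) ->
  hausdorff s A = 0%E.
Proof.
move=> As; apply/eqP; rewrite eq_le hausdorff_ge0 andbT.
pose K := {J : {ffun 'I_n.+1 -> {set 'I_m}} | #|stratum_index J|%:R < s}.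
rewrite -(@hausdorff_countable_bigcup0 _ _ _ K s
    (fun J => range (@stratum_param R n m (val J)))).
  apply: hausdorff_subset => d /As[dd0 ds].
  have [J [cJ Jd]] := stratum_param_rank dd0.
  have Js : #|stratum_index J|%:R < s by rewrite cJ.
  by exists (exist _ J Js).
move=> [J Js]; apply: (@hausdorff_image _ {t | t \in stratum_index J}).
  exact: stratum_param_lipschitz.
by rewrite card_sig.
Qed.

Lemma hdim_chain_complexes_ge (r : nat -> nat) : rank_profile n m r ->
  (stratum_dim n m r)%:R <= hdim (@chain_complexes R n m).
Proof.
move=> [_ _ rr]; apply: lb_le_inf.
  (* The infimum needs a nonempty set of exponents: this one exceeds every possible number of
     parameters. *)
  exists #|{: 'I_n * 'I_m * 'I_m + 'I_n.+1 * 'I_m * 'I_m}|.+1%:R; split=> //.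
  apply: hausdorff_small_strata => d dd0; split=> //.
  by have [J [<- _]] := stratum_param_rank dd0; rewrite ltr_nat ltnS max_card.
by move=> s [s0 Ms]; apply: (chain_complexes_dim_ge _ s0 Ms) => i /ltnW/rr.
Qed.

(** Cutting the pieces of a simple function down to [P] keeps them Borel and of equal measure, so
    both suprema range over the same values. *)
Lemma hintegral_conull (s : R) (Y P : set cfg) (f : cfg -> R) :
  cborel P -> hausdorff s (Y `\` P) = 0%E -> hintegral s (Y `&` P) f = hintegral s Y f.
Proof.
move=> bP YP0; congr ereal_sup; apply/seteqP; split=> v.
  move=> [K [c [A [c0 bA cf dA vE]]]]; exists K, c, A; split=> // j.
  by have [? AYP] := bA j; split=> // x /AYP[].
move=> [K [c [A [c0 bA cf dA ->]]]]; exists K, c, (fun j => A j `&` P); split=> //.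
- move=> j; have [bAj AY] := bA j; split; last by move=> x [/AY].
  exact: (@measurableI _ (g_sigma_algebraType (@copen R n m)) _ _ bAj bP).
- by move=> j x [/cf].
- by move=> j j' /dA AA; rewrite setIACA AA set0I.
apply: eq_bigr => j _; congr (_ * _)%E; apply/esym.
apply: (@hausdorff_setI_conull _ _ _ _ _ _ (Y `\` P)) => // x Ax.
have [Px|nPx] := pselect (P x); [by left|right; split=> //].
by have [_] := bA j; exact.
Qed.

End RankDimension.

Theorem theorem4p3 (R : realType) (n m : nat) (f : cfg R n m -> R) :
  (0 < n)%N -> ~~ odd n -> (0 < m)%N ->
  (* f is a bounded Borel-measurable density on R^N, N = n*m*m *)
  (forall x, 0 <= f x) -> (exists C : R, forall x, f x <= C) -> cborel_fun f ->
  (0 < hintegral (n * m * m)%:R setT f)%E ->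
  (hintegral (n * m * m)%:R setT f < +oo)%E ->
  (* the normalising integral over M(m,...,m) is positive (and finite) *)
  (0 < hintegral (hdim (@chain_complexes R n m)) (@chain_complexes R n m) f)%E ->
  (hintegral (hdim (@chain_complexes R n m)) (@chain_complexes R n m) f < +oo)%E ->
  almost_surely f (fun d =>
    forall k : nat, (k <= n./2)%N ->
      ((betti d (k.*2))%:Z = Num.floor ((m%:R : R) / (n./2).+1%:R)
       \/ (betti d (k.*2))%:Z = Num.ceil ((m%:R : R) / (n./2).+1%:R))).
Proof.
move=> _ n_even _ _ _ _ _ _ pos fin; rewrite /almost_surely /cprob.
set P := (X in _ `&` X); set s := hdim _ in pos fin *.
have nE : n = (n./2).*2 by rewrite -[LHS]odd_double_half (negbTE n_even).
rewrite hintegral_conull.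
(* The probability is now a positive finite number divided by itself. *)
- move: pos fin; case: (hintegral _ _ _) => [x| |]//; rewrite lte_fin => x0 _.
  by rewrite inver gt_eqF// -EFinM divff// gt_eqF.
- exact: (cborel_rank_pred (fun rho => let c j := (\sum_(i < n | (val i).+1 == j) rho i)%N in
    forall k : nat, (k <= n./2)%N ->
      (((m - c k.*2 - c k.*2.+1)%N)%:Z = Num.floor ((m%:R : R) / (n./2).+1%:R)
       \/ ((m - c k.*2 - c k.*2.+1)%N)%:Z = Num.ceil ((m%:R : R) / (n./2).+1%:R)))).
(* An exceptional complex has an unbalanced even Betti number, so its stratum has smaller dimension
   than the balanced one, which bounds [hdim] from below. *)
apply: hausdorff_small_strata => d [dd0 nPd]; split=> //.
have rP := crank_profile dd0; have bP := balanced_rank_profile n./2 m.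
have [k kn unb] : exists2 k, (k <= n./2)%N & ~~ balanced n./2 m (betti d k.*2).
  apply: contrapT => all_balanced; apply: nPd => k kn; apply: balanced_floor_ceil.
  by apply: contrapT => /negP unb; apply: all_balanced; exists k.
rewrite -nE in bP; apply: lt_le_trans (hdim_chain_complexes_ge bP).
have := @stratum_dim_unbalanced n./2 m (crank d) k.
by rewrite -nE ltr_nat => /(_ rP kn unb).
Qed.
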